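(* There exists a $\Gamma_3$-contraction $(S_1,S_2,P)$ on $\mathbb C^2$ whose fundamental operator pair $(A_1,A_2)$ satisfies $A_1A_2\ne A_2A_1$ and $r(A_1)>2$, where $r(A_1)$ denotes the spectral radius of $A_1$.
   Context: $\mathbb D$ is the open unit disc in $\mathbb C$. The closed symmetrized tridisc is $\Gamma_3=\{(z_1+z_2+z_3,\;z_1z_2+z_1z_3+z_2z_3,\;z_1z_2z_3): z_1,z_2,z_3\in\overline{\mathbb D}\}$. A compact set $X\subset\mathbb C^3$ is a spectral set for a commuting triple $\underline T$ of bounded operators if the Taylor joint spectrum $\sigma(\underline T)\subseteq X$ and $\|f(\underline T)\|\le\sup_{x\in X}|f(x)|$ for every rational function $f$ with poles off $X$. A $\Gamma_3$-contraction is a commuting triple $(S_1,S_2,P)$ of bounded operators on a Hilbert space for which $\Gamma_3$ is a spectral set. For a contraction $P$, $D_P=(I-P^*P)^{1/2}$ and $\mathcal D_P=\overline{\operatorname{Ran}}\,D_P$. It is known that for every $\Gamma_3$-contraction $(S_1,S_2,P)$, $P$ is a contraction and there is a unique pair $(A_1,A_2)$ of bounded operators on $\mathcal D_P$ such that $S_1-S_2^*P=D_PA_1D_P$ and $S_2-S_1^*P=D_PA_2D_P$; this is the fundamental operator pair of $(S_1,S_2,P)$. *)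

(* Defs.v *)
From mathcomp Require Import all_boot all_order all_algebra.
From mathcomp Require Import boolp classical_sets reals.
From mathcomp Require Import complex.
From mathcomp Require Import mpoly.

Set Implicit Arguments.
Unset Strict Implicit.
Unset Printing Implicit Defensive.

Import Order.TTheory GRing.Theory Num.Theory.
Import ComplexField.Normc.
Local Open Scope ring_scope.
Local Open Scope classical_set_scope.
Local Open Scope sesquilinear_scope.

(* Operators on the Hilbert space C^n, with C := R[i], are n x n matrices acting
   on column vectors; the adjoint of A is A ^t*.  Points of C^3 and triples of
   operators are 3-tuples. *)

Definition vnorm (R : realType) (n : nat) (v : 'cV[R[i]]_n) : R :=
  Num.sqrt (\sum_i normc (v i 0) ^+ 2).

Definition opnorm (R : realType) (n : nat) (T : 'M[R[i]]_n) : R :=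
  sup [set vnorm (T *m v) | v in [set v | vnorm v <= 1]].

Definition psdmx (R : realType) (n : nat) (M : 'M[R[i]]_n) : Prop :=
  M ^t* = M /\ forall v : 'cV[R[i]]_n, 0 <= (v ^t* *m M *m v) 0 0.

(* The positive square root of a positive semidefinite matrix (0 on matrices
   that are not positive semidefinite). *)
Definition psd_sqrt (R : realType) (n : nat) (M : 'M[R[i]]_n) : 'M[R[i]]_n :=
  xget 0 [set D | psdmx D /\ D *m D = M].

Definition commuting_triple (R : realType) (n : nat)
    (T : 3.-tuple 'M[R[i]]_n) : Prop :=
  forall i j : 'I_3, tnth T i *m tnth T j = tnth T j *m tnth T i.

(* Exactness of the Koszul complex 0 -> V -> V^3 -> V^3 -> V -> 0 of the triple
   (a, b, c) on V = C^n, whose differentials are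
     x            |-> (a x, b x, c x),
     (x, y, z)    |-> (a y - b x, a z - c x, b z - c y),
     (u, v, w)    |-> a w - b v + c u. *)
Definition koszul_exact (R : realType) (n : nat) (a b c : 'M[R[i]]_n) : Prop :=
  [/\ forall x : 'cV[R[i]]_n,
        a *m x = 0 -> b *m x = 0 -> c *m x = 0 -> x = 0,
      forall x y z : 'cV[R[i]]_n,
        a *m y - b *m x = 0 -> a *m z - c *m x = 0 -> b *m z - c *m y = 0 ->
        exists t : 'cV[R[i]]_n, [/\ x = a *m t, y = b *m t & z = c *m t],
      forall u v w : 'cV[R[i]]_n,
        a *m w - b *m v + c *m u = 0 ->
        exists x y z : 'cV[R[i]]_n,
          [/\ u = a *m y - b *m x, v = a *m z - c *m x & w = b *m z - c *m y]
    & forall s : 'cV[R[i]]_n, exists u v w : 'cV[R[i]]_n,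
        s = a *m w - b *m v + c *m u].

Definition taylor_spectrum (R : realType) (n : nat)
    (T : 3.-tuple 'M[R[i]]_n) : set (3.-tuple R[i]) :=
  [set l | ~ koszul_exact (tnth T 0 - (tnth l 0)%:M)
                          (tnth T 1 - (tnth l 1)%:M)
                          (tnth T 2 - (tnth l 2)%:M)].

Definition poly_calculus (R : realType) (n : nat)
    (p : {mpoly R[i][3]}) (T : 3.-tuple 'M[R[i]]_n.+1) : 'M[R[i]]_n.+1 :=
  mmap (@scalar_mx R[i] n.+1) (tnth T) p.

(* X is understood to be compact.  A rational function with poles off X is a quotient
   p / q of polynomials with q nowhere zero on X; when the Taylor spectrum lies
   in X, q(T) is invertible and (p / q)(T) = p(T) q(T)^-1. *)
Definition spectral_set (R : realType) (n : nat)
    (X : set (3.-tuple R[i])) (T : 3.-tuple 'M[R[i]]_n.+1) : Prop :=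
  taylor_spectrum T `<=` X /\
  forall p q : {mpoly R[i][3]},
    (forall x, X x -> q.@[tnth x] != 0) ->
    opnorm (poly_calculus p T *m invmx (poly_calculus q T))
      <= sup [set normc (p.@[tnth x] / q.@[tnth x]) | x in X].

Definition Gamma3 (R : realType) : set (3.-tuple R[i]) :=
  [set x | exists z1 z2 z3 : R[i],
    [/\ normc z1 <= 1, normc z2 <= 1, normc z3 <= 1 &
        x = [tuple z1 + z2 + z3; z1 * z2 + z1 * z3 + z2 * z3; z1 * z2 * z3]]].

Definition Gamma3_contraction (R : realType) (n : nat)
    (S1 S2 P : 'M[R[i]]_n.+1) : Prop :=
  commuting_triple [tuple S1; S2; P] /\
  spectral_set (@Gamma3 R) [tuple S1; S2; P].

Definition defect_op (R : realType) (n : nat) (P : 'M[R[i]]_n) : 'M[R[i]]_n :=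
  psd_sqrt (1%:M - P ^t* *m P).

(* Ran D_P is already closed, since C^n is finite dimensional. *)
Definition defect_space (R : realType) (n : nat) (P : 'M[R[i]]_n) :
    {vspace 'cV[R[i]]_n} :=
  limg (linfun (mulmx (defect_op P) : 'cV[R[i]]_n -> 'cV[R[i]]_n)).

(* D_P A D_P as a map on C^n, for an operator A on the space D_P.  As D_P h lies
   in that space, vsproj only retypes it. *)
Definition defect_sandwich (R : realType) (n : nat) (P : 'M[R[i]]_n)
    (A : 'End(subvs_of (defect_space P))) (h : 'cV[R[i]]_n) : 'cV[R[i]]_n :=
  defect_op P *m vsval (A (vsproj (defect_space P) (defect_op P *m h))).

Definition fundamental_operator_pair (R : realType) (n : nat)
    (S1 S2 P : 'M[R[i]]_n) (A1 A2 : 'End(subvs_of (defect_space P))) : Prop :=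
  (forall h, (S1 - S2 ^t* *m P) *m h = defect_sandwich A1 h) /\
  (forall h, (S2 - S1 ^t* *m P) *m h = defect_sandwich A2 h).

Definition spectrum (R : realType) (V : vectType R[i]) (A : 'End(V)) :
    set R[i] :=
  [set l | ~ exists B : 'End(V),
     (B \o (A - l *: \1))%VF = \1%VF /\ ((A - l *: \1) \o B)%VF = \1%VF].

Definition spectral_radius (R : realType) (V : vectType R[i])
    (A : 'End(V)) : R :=
  sup [set normc l | l in spectrum A].

(* Main.v *)
Require Import Defs.
From mathcomp Require Import all_boot all_order all_algebra.
From mathcomp Require Import boolp classical_sets reals.
From mathcomp Require Import complex.
From mathcomp Require Import mpoly.
From mathcomp Require Import cyclic separable cyclotomic.
From mathcomp Require Import topology normedtype sequences derive.
From mathcomp Require Import ring lra zify.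
Import Order.TTheory GRing.Theory Num.Theory.
Import numFieldNormedType.Exports.
Import ComplexField.Normc.
Local Open Scope ring_scope.
Local Open Scope sesquilinear_scope.

Set Implicit Arguments.
Unset Strict Implicit.
Unset Printing Implicit Defensive.

(** The example is [(3 T, 3 T^2, T^3)], the image of [(T, T, T)] under the
    symmetrization map, for the contraction [T = [[0, 1], [c, 0]]] with
    [c = 3/4].  Since [T^2 = c], the triple is [(3 T, 3 c, c T)].

    Why the spectral radius can pass 2.  For the unilateral shift in place of
    [T], the first fundamental operator is 3 times the nilpotent Jordan block
    of size 3, whose numerical radius is [3 / sqrt 2 > 2]; for a contraction
    with one-dimensional defect one gets compressions of that block to
    subspaces of [C^3].  Eigenvalues [a, -a] of [T] give the subspace spanned
    by [(1, a, a^2)] and [(1, -a, a^2)], on which the compression has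
    eigenvalues [3 a / sqrt (1 + a^4)] and its opposite.  With [c = a^2] this
    exceeds 2 in modulus as soon as [4 c^2 - 9 c + 4 < 0], which holds at
    [c = 3/4]; there moreover [1 + c^2 = (5/4)^2].  Concretely [A_1] is a
    similar copy of [(12/5) T], its square is [108/25 > 4], and [A_2] is, up to
    a scalar, a rank one projection that does not commute with it
    ([fundamental_pair_of_example]).

    Why the triple is a Gamma_3-contraction.  A quotient [p / q] of polynomials
    pulls back along [z |-> (3 z, 3 z^2, z^3)] to a rational function [f] of one
    variable without poles on the closed disc, so what is needed is von
    Neumann's inequality for [T] ([von_neumann]).  The matrix
    [T_w = [[0, 1], [w, 0]]] is unitary for [|w| = 1], with orthogonal
    eigenvectors [(1, r)], [(1, -r)] where [r^2 = w], so [|f(T_w)| <= sup |f|]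
    there.  The coefficients of [f(T_w)] are rational functions of [w] without
    poles on the closed disc, hence the maximum principle
    ([max_modulus_ratio]) carries the bound from the circle to [w = c].  The
    maximum principle itself comes from Cauchy's estimate, proved by averaging
    over roots of unity, applied to the powers of a polynomial.

    The positive square root [D_P] never has to be computed: [D_P^2] determines
    the spectrum of [A_1 = D_P^-1 (S_1 - S_2^* P) D_P^-1] and whether [A_1] and
    [A_2] commute. *)

(** * The maximum principle for rational functions *)

Section MaximumPrinciple.
Variable R : realType.
Local Notation C := R[i].
Implicit Types (p q : {poly C}) (z c x : C).

Lemma normCE x : `|x| = (normc x)%:C%C. Proof. by []. Qed.

Lemma normc_ge0 x : 0 <= normc x.
Proof. by rewrite -lecR -normCE normr_ge0. Qed.

Lemma normc_gt0 x : (0 < normc x) = (x != 0).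
Proof. by rewrite -ltcR -normCE normr_gt0. Qed.

Lemma normcX x n : normc (x ^+ n) = normc x ^+ n.
Proof. by apply: complexI; rewrite rmorphXn /= -!normCE normrX. Qed.

Lemma normc_sqrtc z : normc (sqrtc z) ^+ 2 = normc z.
Proof. by rewrite -normcX sqr_sqrtc. Qed.

Lemma normc_sqrtc_le1 z : normc z <= 1 -> normc (sqrtc z) <= 1.
Proof.
move=> z1.
by rewrite -(@ler_sqr _ _ 1) ?nnegrE ?normc_ge0 // normc_sqrtc expr1n.
Qed.

Lemma geometric_le0 (d K t : R) : 0 <= t < 1 ->
  (forall n, d <= K * t ^+ n) -> d <= 0.
Proof.
move=> /andP[t0 t1] dK.
have t1n : `|t| < 1 by rewrite ger0_norm.
have Kt := @cvg_geometric R K t t1n.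
apply: (@ler_cvg_to _ eventually _ _ (fun=> d) (geometric K t) d 0 _ Kt).
  exact: cvg_cst.
by apply: nearW => n; exact: dK.
Qed.

Lemma prim_root_exists n : (0 < n)%N -> exists z : C, n.-primitive_root z.
Proof.
move=> n0; pose p : {poly C} := 'X^n - 1.
have [r Dp] := closed_field_poly_normal p.
have pm : p \is monic by apply: monicXnsubC.
rewrite (monicP pm) scale1r in Dp.
have szr : size r = n.
  by have := size_XnsubC (1 : C) n0; rewrite -/p Dp size_prod_XsubC => -[].
have : has n.-primitive_root r.
  apply: has_prim_root => //; last by rewrite szr.
    by apply/allP => z; rewrite -root_prod_XsubC -Dp.
  rewrite -separable_prod_XsubC -Dp separable_Xn_sub_1 //.
  by rewrite pnatr_eq0 -lt0n.
by case/hasP => z _ zn; exists z.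
Qed.

Lemma sum_prim_root n z j : n.-primitive_root z ->
  \sum_(k < n) (z ^+ k) ^+ j = if (n %| j)%N then n%:R else 0.
Proof.
move=> zn; case: ifP => nj.
  rewrite (eq_bigr (fun=> 1)) ?sumr_const ?card_ord // => k _.
  by rewrite exprAC (eqP (_ : z ^+ j == 1)) ?expr1n // -(prim_order_dvd zn).
have zj : z ^+ j != 1 by rewrite -(prim_order_dvd zn) nj.
apply: (mulfI (x := z ^+ j - 1)); first by rewrite subr_eq0.
rewrite mulr0 (eq_bigr (fun k : 'I_n => (z ^+ j) ^+ k)); last first.
  by move=> k _; rewrite exprAC.
by rewrite -subrX1 exprAC (prim_expr_order zn) expr1n subrr.
Qed.

(** Cauchy's estimate: for [n > deg p], the discrete Fourier transform over the
    [n]-th roots of unity recovers the coefficients of [p] exactly, so the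
    integral over the circle can be replaced by a finite average. *)
Lemma cauchy_coef p (M : C) : (forall z, `|z| = 1 -> `|p.[z]| <= M) ->
  forall i, `|p`_i| <= M.
Proof.
move=> pM i; set n := maxn (size p) i.+1.
have n0 : (0 < n)%N by rewrite leq_max orbT.
have [z zn] := prim_root_exists n0.
have z1 : `|z| = 1.
  by apply/eqP; rewrite -(@pexpr_eq1 _ _ n) // -normrX (prim_expr_order zn) normr1.
have le_i_n : (i < n)%N by rewrite leq_max leqnn orbT.
(* The exponent n - i stands for - i, as the n-th powers are 1. *)
have E : n%:R * p`_i = \sum_(k < n) p.[z ^+ k] * (z ^+ k) ^+ (n - i).
  under eq_bigr do
    rewrite (horner_coef_wide _ (leq_maxl _ _ : (size p <= n)%N)) mulr_suml.
  rewrite exchange_big /= (bigD1 (Ordinal le_i_n)) //= [X in _ + X]big1 ?addr0.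
    under eq_bigr do rewrite -mulrA -exprD subnKC 1?ltnW //.
    by rewrite -mulr_sumr (sum_prim_root _ zn) dvdnn mulrC.
  move=> m mi; under eq_bigr do rewrite -mulrA -exprD.
  rewrite -mulr_sumr (sum_prim_root _ zn) ifF ?mulr0 //.
  apply/negbTE; apply/negP => /dvdnP[k Hk].
  have mn := ltn_ord m; move/eqP: mi; apply; apply: val_inj => /=.
  have [k0|k1] := leqP k 1; last first.
    have : (2 * n <= k * n)%N by rewrite leq_mul2r k1 orbT.
    by rewrite -Hk; lia.
  by case: k k0 Hk => [|[|//]] _ Hk; lia.
rewrite -(ler_pM2l (_ : 0 < n%:R :> C)) ?ltr0n //.
rewrite -[X in X * `|_|](@ger0_norm C) ?ler0n //.
rewrite -normrM E (le_trans (ler_norm_sum _ _ _)) //.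
rewrite mulr_natl -[X in _ <= _ *+ X]card_ord -sumr_const ler_sum // => k _.
by rewrite normrM !normrX z1 !expr1n mulr1 pM // normrX z1 expr1n.
Qed.

(** Cauchy's estimate only gives [|p(c)| <= M / (1 - |c|)].  Applied to [p ^+ k]
    it bounds [|p(c)|^k] by [M^k / (1 - |c|)], with the same denominator for
    all [k], which forces [|p(c)| <= M]. *)
Lemma max_modulus_poly p c (M : R) :
  (forall z, normc z = 1 -> normc p.[z] <= M) -> normc c < 1 -> normc p.[c] <= M.
Proof.
move=> pM c1; rewrite leNgt; apply/negP => Mx.
have M0 : 0 <= M by apply: le_trans (pM 1 _); rewrite ?normc_ge0 // normc1.
have x0 := le_lt_trans M0 Mx; set x := normc p.[c] in Mx x0.
have c1' : 0 < 1 - normc c by rewrite subr_gt0.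
have Xk k : x ^+ k <= (1 - normc c)^-1 * M ^+ k.
  rewrite -(ler_pM2l c1') mulVKf ?gt_eqF //.
  rewrite -lecR rmorphM rmorphB rmorph1 /= !rmorphXn /=.
  rewrite -!normCE -normrX -horner_exp horner_coef.
  have pk : forall i, `|(p ^+ k)`_i| <= (M ^+ k)%:C%C.
    apply: cauchy_coef => z z1.
    rewrite horner_exp normCE lecR normcX lerXn2r ?nnegrE ?normc_ge0 ?pM //.
    by apply: complexI; rewrite -normCE.
  have cC : 0 < 1 - `|c| by rewrite normCE -[X in X - _]/(1%:C%C) -rmorphB ltcR.
  have le1 : (1 - `|c|) * (\sum_(i < size (p ^+ k)) `|c| ^+ i) <= 1.
    by rewrite -opprB mulNr -subrX1 opprB gerBl exprn_ge0.
  have le2 : `|\sum_(i < size (p ^+ k)) (p ^+ k)`_i * c ^+ i|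
      <= (\sum_(i < size (p ^+ k)) `|c| ^+ i) * (M ^+ k)%:C%C.
    apply: le_trans (ler_norm_sum _ _ _) _; rewrite mulr_suml ler_sum // => i _.
    by rewrite normrM normrX mulrC ler_wpM2l ?exprn_ge0.
  apply: le_trans (ler_wpM2l (ltW cC) le2) _.
  by rewrite mulrA -rmorphXn ler_piMl // ler0c exprn_ge0.
suff : (1 : R) <= 0 by rewrite ler10.
apply: (@geometric_le0 _ (1 - normc c)^-1 (M / x)).
  by rewrite divr_ge0 ?(ltW x0) //= ltr_pdivrMr // mul1r.
by move=> n; rewrite expr_div_n mulrA ler_pdivlMr ?exprn_gt0 // mul1r.
Qed.

(** The roots of [D] are removed one at a time.  For a root [b], outside the
    closed disc, the truncated geometric series [g] of length [n] satisfies
    [(X - b) g = b ((X / b)^n - 1)], so trading the factor [X - b] of [D] for a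
    factor [g] of [N] changes the ratio only by a factor between
    [1 - |b|^-n] and [1 + |b|^-n], up to the constant [b]; then [n] tends to
    infinity. *)
Lemma max_modulus_ratio (N D : {poly C}) c (M : R) :
  (forall z, normc z <= 1 -> D.[z] != 0) ->
  (forall z, normc z = 1 -> normc N.[z] <= M * normc D.[z]) ->
  normc c < 1 -> normc N.[c] <= M * normc D.[c].
Proof.
move=> D0 ND c1; have [r Dr] := closed_field_poly_normal D.
have M0 : 0 <= M.
  have n1 : normc (1 : C) = 1 by rewrite normc1.
  have D1 : 0 < normc D.[1] by rewrite normc_gt0 D0 ?n1.
  by rewrite -(pmulr_lge0 _ D1); apply: le_trans (ND _ n1); exact: normc_ge0.
have lD : lead_coef D != 0.
  by apply: contraNneq (D0 1 _) => [l0|]; rewrite ?normc1 // Dr l0 scale0r horner0.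
have {D0}r1 : all (fun b => 1 < normc b) r.
  apply/allP => b br; rewrite ltNge; apply/negP => /D0/negP; apply.
  by rewrite -[_ == _]/(root D b) Dr rootZ // root_prod_XsubC.
move: (lead_coef D) Dr lD => l Dr l0; move: ND; rewrite {D}Dr.
elim: r N M M0 r1 => [|b r IH] N M M0 /=.
  move=> _ ND; rewrite big_nil hornerZ hornerC mulr1.
  apply: max_modulus_poly => // z z1; rewrite (le_trans (ND _ z1)) //.
  by rewrite big_nil hornerZ hornerC mulr1.
case/andP=> b1 r1; rewrite big_cons scalerAr; set D := l *: _ => ND.
have nb0 : 0 < normc b by apply: lt_trans b1.
have b0 : b != 0 by rewrite -normc_gt0.
have bV : normc b^-1 < 1 by rewrite normcV invf_lt1.
pose g n : {poly C} := \sum_(k < n) (b^-1 *: 'X) ^+ k.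
have gE n z : (z - b) * (g n).[z] = b * ((b^-1 * z) ^+ n - 1).
  rewrite subrX1 mulrA mulrBr mulVKf // mulr1 horner_sum; congr (_ * _).
  by apply: eq_bigr => i _; rewrite horner_exp hornerZ hornerX.
have ht n z : normc z <= 1 -> normc ((b^-1 * z) ^+ n) <= normc b^-1 ^+ n.
  move=> z1; rewrite normcX normcM.
  by rewrite lerXn2r ?nnegrE ?mulr_ge0 ?normc_ge0 // ler_piMr ?normc_ge0.
have bound n : normc N.[c] * (1 - normc b^-1 ^+ n) <=
    M * normc (('X - b%:P) * D).[c] * (1 + normc b^-1 ^+ n).
  have b_ge0 : 0 <= 1 + normc b^-1 ^+ n by rewrite addr_ge0 ?exprn_ge0 ?normc_ge0.
  have : normc (N * g n).[c] <= M * normc b * (1 + normc b^-1 ^+ n) * normc D.[c].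
    apply: IH => //; first by rewrite !mulr_ge0 // ltW.
    move=> z z1; rewrite hornerM normcM.
    apply: le_trans (ler_wpM2r (normc_ge0 _) (ND _ z1)) _.
    have -> : M * normc (('X - b%:P) * D).[z] * normc (g n).[z]
        = M * normc ((z - b) * (g n).[z]) * normc D.[z].
      by rewrite hornerM hornerXsubC !normcM; ring.
    rewrite gE normcM !mulrA ler_wpM2r ?normc_ge0 //.
    rewrite ler_wpM2l ?mulr_ge0 ?(ltW nb0) //.
    by apply: le_trans (le_normcD _ _) _; rewrite normcN normc1 addrC lerD2l ht ?z1.
  rewrite hornerM normcM => /(ler_wpM2l (normc_ge0 (c - b))).
  rewrite mulrCA -normcM gE normcM => H.
  rewrite hornerM hornerXsubC normcM -(ler_pM2l nb0).
  apply: le_trans (_ : normc N.[c] * (normc b * normc ((b^-1 * c) ^+ n - 1)) <= _).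
    rewrite mulrCA ler_wpM2l ?normc_ge0 // ler_wpM2l ?(ltW nb0) //.
    have := le_normcD ((b^-1 * c) ^+ n) (1 - (b^-1 * c) ^+ n).
    rewrite addrC subrK normc1 -[normc (1 - _)]normcN opprB.
    by have := ht n c (ltW c1); lra.
  by apply: le_trans H _; rewrite le_eqVlt; apply/orP; left; apply/eqP; ring.
rewrite -subr_le0.
apply: (@geometric_le0 _
  (normc N.[c] + M * normc (('X - b%:P) * D).[c]) (normc b^-1)).
  by rewrite normc_ge0.
by move=> n; have := bound n; lra.
Qed.

End MaximumPrinciple.

(** * Von Neumann's inequality for a weighted swap *)

Section VonNeumann.
Variable R : realType.
Local Notation C := R[i].
Implicit Types (P Q : {poly C}) (z c x y : C).

Lemma sqr_normc x : normc x ^+ 2 = complex.Re x ^+ 2 + complex.Im x ^+ 2.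
Proof. by case: x => a b /=; rewrite sqr_sqrtr // addr_ge0 ?sqr_ge0. Qed.

Lemma sqr_normc_parallelogram x y :
  normc (x + y) ^+ 2 + normc (x - y) ^+ 2 = 2 * (normc x ^+ 2 + normc y ^+ 2).
Proof. by rewrite !sqr_normc; case: x y => [a b] [a' b'] /=; ring. Qed.

Definition norm2 x y : R := Num.sqrt (normc x ^+ 2 + normc y ^+ 2).

Lemma norm2_cauchy_schwarz (v1 v2 y1 y2 : C) :
  normc (conjc v1 * y1 + conjc v2 * y2) <= norm2 v1 v2 * norm2 y1 y2.
Proof.
rewrite -(ler_sqr (_ : _ \is Num.nneg)) ?nnegrE ?normc_ge0 ?mulr_ge0 ?sqrtr_ge0 //.
rewrite exprMn !sqr_sqrtr ?addr_ge0 ?sqr_ge0 // !sqr_normc.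
case: v1 v2 y1 y2 => [a b] [a' b'] [d e] [d' e'] /=.
rewrite -subr_ge0.
(* Lagrange's identity: the gap is |v1 y2 - v2 y1|^2 up to conjugations. *)
have -> : (a ^+ 2 + b ^+ 2 + (a' ^+ 2 + b' ^+ 2))
    * (d ^+ 2 + e ^+ 2 + (d' ^+ 2 + e' ^+ 2)) -
  ((a * d - - b * e + (a' * d' - - b' * e')) ^+ 2 +
   (a * e + - b * d + (a' * e' + - b' * d')) ^+ 2)
  = (a * d' - b * e' - (a' * d - b' * e)) ^+ 2
    + (a * e' + b * d' - (a' * e + b' * d)) ^+ 2 by ring.
by rewrite addr_ge0 ?sqr_ge0.
Qed.

Lemma norm2_le (x y u v : C) (K : R) : 0 <= K ->
  normc x ^+ 2 + normc y ^+ 2 <= K ^+ 2 * (normc u ^+ 2 + normc v ^+ 2) ->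
  norm2 x y <= K * norm2 u v.
Proof.
move=> K0 H.
rewrite -(ler_sqr (_ : _ \is Num.nneg)) ?nnegrE ?mulr_ge0 ?sqrtr_ge0 //.
by rewrite exprMn !sqr_sqrtr ?addr_ge0 ?sqr_ge0.
Qed.

Lemma norm2M (k x y : C) : norm2 (k * x) (k * y) = normc k * norm2 x y.
Proof.
rewrite /norm2 !normcM !exprMn -mulrDr sqrtrM ?sqr_ge0 // sqrtr_sqr ger0_norm //.
exact: normc_ge0.
Qed.

Lemma sqr_norm2 x y : conjc x * x + conjc y * y = (norm2 x y ^+ 2)%:C%C.
Proof.
rewrite sqr_sqrtr ?addr_ge0 ?sqr_ge0 // !sqr_normc.
case: x y => [a b] [a' b']; apply/eqP; rewrite eq_complex /=.
by apply/andP; split; apply/eqP; ring.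
Qed.

(** The matrix with eigenvalues [ap], [am] on the orthogonal vectors [(1, r)],
    [(1, - r)] has norm at most [max |ap| |am|]; [a] and [b] are the
    coordinates of the argument in that basis. *)
Lemma norm2_orthogonal_eigenvectors (a b r ap am : C) (K : R) :
  normc r = 1 -> 0 <= K -> normc ap <= K -> normc am <= K ->
  norm2 (a * ap + b * am) (r * (a * ap - b * am))
    <= K * norm2 (a + b) (r * (a - b)).
Proof.
move=> r1 K0 apK amK; apply: norm2_le => //.
rewrite !(normcM r) r1 !mul1r !sqr_normc_parallelogram !normcM !exprMn.
have sqK t : 0 <= t <= K -> t ^+ 2 <= K ^+ 2.
  by case/andP=> t0 tK; rewrite lerXn2r ?nnegrE.
have apK2 := sqK (normc ap); have amK2 := sqK (normc am).
have := ler_wpM2l (sqr_ge0 (normc a)) (apK2 _).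
have := ler_wpM2l (sqr_ge0 (normc b)) (amK2 _).
rewrite !normc_ge0 apK amK => /(_ isT) H1 /(_ isT) H2.
lra.
Qed.

Lemma horner_even_odd P z :
  P.[z] = (even_poly P).[z ^+ 2] + (odd_poly P).[z ^+ 2] * z.
Proof.
by rewrite -{1}(poly_even_odd P) hornerD hornerM !horner_comp hornerXn hornerX.
Qed.

(** Von Neumann's inequality in coordinates: for [T_w = [[0, 1], [w, 0]]] one has
    [P(T_w) = P_e(w) + P_o(w) T_w], where [P_e] and [P_o] are the even and odd
    parts.  Multiplying numerator and denominator of [P / Q] by [Q(- X)] makes
    the denominator a polynomial [D] in [X^2], so that
    [(P / Q)(T_w) = (A(w) + B(w) T_w) / D(w)].  The maximum principle is applied
    to the coefficient of this matrix between [u = Q(T_c) x] and the very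
    vector [v = D(c) P(T_c) x] whose norm is to be bounded. *)
Lemma von_neumann_even_odd P Q c (M : R) (x1 x2 : C) :
  (forall z, normc z <= 1 -> Q.[z] != 0) ->
  (forall z, normc z = 1 -> normc P.[z] <= M * normc Q.[z]) ->
  normc c < 1 ->
  norm2 ((even_poly P).[c] * x1 + (odd_poly P).[c] * x2)
        (c * (odd_poly P).[c] * x1 + (even_poly P).[c] * x2)
  <= M * norm2 ((even_poly Q).[c] * x1 + (odd_poly Q).[c] * x2)
               (c * (odd_poly Q).[c] * x1 + (even_poly Q).[c] * x2).
Proof.
move=> Q0 PQ c1.
have M0 : 0 <= M.
  have n1 : normc (1 : C) = 1 by rewrite normc1.
  have Q1 : 0 < normc Q.[1] by rewrite normc_gt0 Q0 ?n1.
  by rewrite -(pmulr_lge0 _ Q1); apply: le_trans (PQ _ n1); exact: normc_ge0.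
pose Pe := even_poly P; pose Po := odd_poly P.
pose Qe := even_poly Q; pose Qo := odd_poly Q.
pose A := Pe * Qe - 'X * Po * Qo; pose B := Po * Qe - Pe * Qo.
pose D := Qe ^+ 2 - 'X * Qo ^+ 2.
have DE r : D.[r ^+ 2] = Q.[r] * Q.[- r].
  rewrite (horner_even_odd Q r) (horner_even_odd Q (- r)) sqrrN -/Qe -/Qo /D.
  by rewrite !(hornerD, hornerN, hornerM, hornerX, hornerZ, horner_exp); ring.
have ABE r : A.[r ^+ 2] + r * B.[r ^+ 2] = P.[r] * Q.[- r].
  rewrite (horner_even_odd P r) (horner_even_odd Q (- r)) sqrrN -/Pe -/Po -/Qe -/Qo.
  by rewrite /A /B !(hornerD, hornerN, hornerM, hornerX, hornerZ, horner_exp); ring.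
rewrite -/Pe -/Po -/Qe -/Qo.
set y1 := Pe.[c] * x1 + _; set y2 := c * Po.[c] * x1 + _.
set u1 := Qe.[c] * x1 + _; set u2 := c * Qo.[c] * x1 + _.
pose v1 := A.[c] * u1 + B.[c] * u2; pose v2 := c * B.[c] * u1 + A.[c] * u2.
have v1E : v1 = D.[c] * y1.
  rewrite /v1 /y1 /u1 /u2 /A /B /D.
  by rewrite !(hornerD, hornerN, hornerM, hornerX, hornerZ, horner_exp); ring.
have v2E : v2 = D.[c] * y2.
  rewrite /v2 /y2 /u1 /u2 /A /B /D.
  by rewrite !(hornerD, hornerN, hornerM, hornerX, hornerZ, horner_exp); ring.
pose N := conjc v1 *: (u1 *: A + u2 *: B) + conjc v2 *: (u1 *: ('X * B) + u2 *: A).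
have Dnz z : normc z <= 1 -> D.[z] != 0.
  by move=> /normc_sqrtc_le1 r1; rewrite -(sqr_sqrtc z) DE mulf_neq0 ?Q0 ?normcN.
have : normc N.[c] <= M * norm2 u1 u2 * norm2 v1 v2 * normc D.[c].
  apply: max_modulus_ratio => // w w1.
  have wE := sqr_sqrtc w; have r1 := normc_sqrtc w; set r := sqrtc w in wE r1.
  have {}r1 : normc r = 1.
    by apply/eqP; rewrite -(@pexpr_eq1 _ _ 2) ?normc_ge0 // r1 w1.
  have r0 : r != 0 by rewrite -normc_gt0 r1.
  pose a := (u1 + u2 / r) / 2; pose b := (u1 - u2 / r) / 2.
  have u1E : u1 = a + b by rewrite /a /b; field.
  have u2E : u2 = r * (a - b) by rewrite /a /b; field.
  pose ap := A.[w] + r * B.[w]; pose am := A.[w] - r * B.[w].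
  have K0 : 0 <= M * normc D.[w] by rewrite mulr_ge0 ?normc_ge0.
  have apK : normc ap <= M * normc D.[w].
    by rewrite /ap -wE ABE DE !normcM mulrA ler_wpM2r ?normc_ge0 // PQ.
  have amK : normc am <= M * normc D.[w].
    have -> : am = P.[- r] * Q.[r].
      by have := ABE (- r); rewrite sqrrN wE opprK => <-; rewrite mulNr.
    by rewrite -wE DE !normcM mulrA mulrAC ler_wpM2r ?normc_ge0 // PQ // normcN.
  have := norm2_orthogonal_eigenvectors a b r1 K0 apK amK.
  rewrite -u1E -u2E => le1.
  have -> : N.[w] = conjc v1 * (a * ap + b * am) + conjc v2 * (r * (a * ap - b * am)).
    rewrite /N /ap /am /A /B !(hornerD, hornerN, hornerM, hornerX, hornerZ, horner_exp).
    by rewrite u1E u2E -wE; ring.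
  apply: le_trans (norm2_cauchy_schwarz _ _ _ _) _.
  apply: le_trans (ler_wpM2l (sqrtr_ge0 _) le1) _.
  by rewrite le_eqVlt /norm2; apply/orP; left; apply/eqP; ring.
have -> : N.[c] = (norm2 v1 v2 ^+ 2)%:C%C.
  rewrite -sqr_norm2 /N /v1 /v2 /A /B.
  by rewrite !(hornerD, hornerN, hornerM, hornerX, hornerZ, horner_exp); ring.
have dc : 0 < normc D.[c] by rewrite normc_gt0 Dnz // ltW.
have -> : normc (norm2 v1 v2 ^+ 2)%:C%C = norm2 v1 v2 ^+ 2.
  by apply: complexI; rewrite -normCE ger0_norm // ler0c sqr_ge0.
rewrite v1E v2E norm2M.
have := sqrtr_ge0 (normc y1 ^+ 2 + normc y2 ^+ 2); rewrite -/(norm2 y1 y2).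
rewrite le_eqVlt => /predU1P[<- _|y0].
  by rewrite mulr_ge0 ?sqrtr_ge0.
have -> : (normc D.[c] * norm2 y1 y2) ^+ 2
  = norm2 y1 y2 * (normc D.[c] ^+ 2 * norm2 y1 y2) by ring.
have -> : M * norm2 u1 u2 * (normc D.[c] * norm2 y1 y2) * normc D.[c]
  = M * norm2 u1 u2 * (normc D.[c] ^+ 2 * norm2 y1 y2) by ring.
by rewrite ler_pM2r // mulr_gt0 ?exprn_gt0.
Qed.

Definition weighted_swap c : 'M[C]_2 :=
  \matrix_(i, j) (if i == 0 then (j == 1)%:R else c * (j == 0)%:R).

Lemma weighted_swap_sqr c : weighted_swap c *m weighted_swap c = c%:M.
Proof.
apply/matrixP => i j; rewrite !mxE !big_ord_recl big_ord0 !mxE.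
by case: i j => [[|[|//]] ?] [[|[|//]] ?] /=;
  rewrite !(mul0r, mulr0, mul1r, mulr1, addr0, add0r, mulr0n, mulr1n).
Qed.

Lemma horner_weighted_swap c P :
  horner_mx (weighted_swap c) P
  = (even_poly P).[c]%:M + (odd_poly P).[c] *: weighted_swap c.
Proof.
have sqE (q : {poly C}) : horner_mx (weighted_swap c) (q \Po 'X^2) = q.[c]%:M.
  rewrite comp_polyE rmorph_sum horner_coef /= raddf_sum /=; apply: eq_bigr => i _.
  rewrite linearZ /= !rmorphXn /= horner_mx_X.
  rewrite expr2 -[_ * _]/(_ *m _) weighted_swap_sqr -rmorphXn /=.
  by rewrite -mul_scalar_mx -scalar_mxM.
rewrite -{1}(poly_even_odd P) rmorphD rmorphM /= horner_mx_X !sqE.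
by rewrite -[_ * _]/(_ *m _) mul_scalar_mx.
Qed.

(** The determinant is [Q(r) Q(- r)] with [r^2 = c]. *)
Lemma horner_weighted_swap_unit c Q : normc c < 1 ->
  (forall z, normc z <= 1 -> Q.[z] != 0) ->
  horner_mx (weighted_swap c) Q \in unitmx.
Proof.
move=> c1 Q0; set a := (even_poly Q).[c]; set b := (odd_poly Q).[c].
suff d0 : a ^+ 2 - c * b ^+ 2 != 0.
  suff /mulmx1_unit[] : horner_mx (weighted_swap c) Q
      *m ((a ^+ 2 - c * b ^+ 2)^-1 *: (a%:M - b *: weighted_swap c)) = 1%:M by [].
  rewrite horner_weighted_swap -/a -/b -scalemxAr mulmxDl !mulmxBr.
  rewrite -!scalemxAl -!scalemxAr weighted_swap_sqr !mul_scalar_mx mul_mx_scalar.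
  rewrite addrA subrK !scale_scalar_mx -raddfB /= scale_scalar_mx.
  by congr (_%:M); rewrite -[RHS](mulVf d0); congr (_ * _); ring.
have r1 := normc_sqrtc_le1 (ltW c1).
have := mulf_neq0 (Q0 _ r1) (Q0 (- sqrtc c) _); rewrite normcN r1 => /(_ isT).
rewrite (horner_even_odd Q (sqrtc c)) (horner_even_odd Q (- _)) sqrrN sqr_sqrtc.
by congr (_ != 0); rewrite -/a -/b -{3}(sqr_sqrtc c); ring.
Qed.

Lemma vnormE (v : 'cV[C]_2) : vnorm v = norm2 (v 0 0) (v 1 0).
Proof.
rewrite /vnorm !big_ord_recl big_ord0 addr0 /norm2.
by congr (Num.sqrt (_ + normc (v _ _) ^+ 2)); apply: val_inj.
Qed.

Lemma von_neumann c P Q (M : R) (x : 'cV[C]_2) : normc c < 1 ->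
  (forall z, normc z <= 1 -> Q.[z] != 0) ->
  (forall z, normc z = 1 -> normc P.[z] <= M * normc Q.[z]) ->
  vnorm (horner_mx (weighted_swap c) P *m x)
    <= M * vnorm (horner_mx (weighted_swap c) Q *m x).
Proof.
move=> c1 Q0 PQ; have := von_neumann_even_odd (x 0 0) (x 1 0) Q0 PQ c1.
have E p : vnorm (horner_mx (weighted_swap c) p *m x) =
  norm2 ((even_poly p).[c] * x 0 0 + (odd_poly p).[c] * x 1 0)
        (c * (odd_poly p).[c] * x 0 0 + (even_poly p).[c] * x 1 0).
  rewrite vnormE horner_weighted_swap !mxE !big_ord_recl !big_ord0 !mxE /=.
  rewrite (_ : lift 0 0 = 1); last exact: val_inj.
  by congr norm2; rewrite ?(mulr1n, mulr0n, mulr0, mulr1, addr0, add0r) // [c * _]mulrC.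
by rewrite !E.
Qed.

End VonNeumann.

(** * Rational functions are bounded on the symmetrized tridisc *)

Section Compactness.
Variable R : realType.
Local Notation C := R[i].
Implicit Type X : topologicalType.

(** Continuity is read on real and imaginary parts, so that only the topology
    of the real line is involved. *)
Definition ccontinuous X (f : X -> C) : Prop :=
  continuous (fun a => complex.Re (f a)) /\ continuous (fun a => complex.Im (f a)).

Lemma ccontinuous_cst X (k : C) : ccontinuous (fun _ : X => k).
Proof. by split=> a; apply: cvg_cst. Qed.

Lemma ccontinuousD X (f g : X -> C) :
  ccontinuous f -> ccontinuous g -> ccontinuous (fun a => f a + g a).
Proof.
have ReD (x y : C) : complex.Re (x + y) = complex.Re x + complex.Re y.
  by case: x y => [? ?] [? ?].
have ImD (x y : C) : complex.Im (x + y) = complex.Im x + complex.Im y.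
  by case: x y => [? ?] [? ?].
move=> [f1 f2] [g1 g2]; split.
  by under eq_fun do rewrite ReD; move=> a; apply: cvgD; [exact: f1|exact: g1].
by under eq_fun do rewrite ImD; move=> a; apply: cvgD; [exact: f2|exact: g2].
Qed.

Lemma ccontinuousM X (f g : X -> C) :
  ccontinuous f -> ccontinuous g -> ccontinuous (fun a => f a * g a).
Proof.
have ReM (x y : C) : complex.Re (x * y)
    = complex.Re x * complex.Re y - complex.Im x * complex.Im y.
  by case: x y => [? ?] [? ?].
have ImM (x y : C) : complex.Im (x * y)
    = complex.Re x * complex.Im y + complex.Im x * complex.Re y.
  by case: x y => [? ?] [? ?].
move=> [f1 f2] [g1 g2]; split.
  under eq_fun do rewrite ReM.
  by move=> a; apply: cvgB; apply: cvgM;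
    (exact: f1 || exact: f2 || exact: g1 || exact: g2).
under eq_fun do rewrite ImM.
by move=> a; apply: cvgD; apply: cvgM;
  (exact: f1 || exact: f2 || exact: g1 || exact: g2).
Qed.

Lemma ccontinuous_sum X (I : Type) (r : seq I) (f : I -> X -> C) :
  (forall i, ccontinuous (f i)) -> ccontinuous (fun a => \sum_(i <- r) f i a).
Proof.
move=> cf; elim: r => [|i r IH].
  by under eq_fun do rewrite big_nil; apply: ccontinuous_cst.
by under eq_fun do rewrite big_cons; apply: ccontinuousD.
Qed.

Lemma ccontinuous_prod X (I : Type) (r : seq I) (f : I -> X -> C) :
  (forall i, ccontinuous (f i)) -> ccontinuous (fun a => \prod_(i <- r) f i a).
Proof.
move=> cf; elim: r => [|i r IH].
  by under eq_fun do rewrite big_nil; apply: ccontinuous_cst.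
by under eq_fun do rewrite big_cons; apply: ccontinuousM.
Qed.

Lemma ccontinuousX X (f : X -> C) n :
  ccontinuous f -> ccontinuous (fun a => f a ^+ n).
Proof.
move=> cf; elim: n => [|n IH].
  by under eq_fun do rewrite expr0; apply: ccontinuous_cst.
by under eq_fun do rewrite exprS; apply: ccontinuousM.
Qed.

Lemma ccontinuous_meval X n (p : {mpoly C[n]}) (h : X -> 'I_n -> C) :
  (forall i, ccontinuous (h^~ i)) -> ccontinuous (fun a => p.@[h a]).
Proof.
move=> ch; under eq_fun do rewrite mevalE.
apply: ccontinuous_sum => m; apply: ccontinuousM; first exact: ccontinuous_cst.
by apply: ccontinuous_prod => i; apply: ccontinuousX.
Qed.

Definition disc : set (R * R) := [set a | a.1 ^+ 2 + a.2 ^+ 2 <= 1]%classic.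

Lemma compact_disc : compact disc.
Proof.
have cI := @segment_compact R (-1) 1.
apply: (subclosed_compact _ (compact_setX cI cI)).
  apply: (@preimage_closed _ _ (fun a : R * R => a.1 ^+ 2 + a.2 ^+ 2)
    [set x | x <= 1]%classic); last exact: closed_le.
  move=> a _; under eq_fun do rewrite !expr2.
  by apply: cvgD; apply: cvgM; (exact: cvg_fst || exact: cvg_snd).
have sq1 (x y : R) : x ^+ 2 + y ^+ 2 <= 1 -> (-1 <= x <= 1).
  by move=> h; have y0 := sqr_ge0 y; apply/andP; split; nra.
by move=> [x y] h; split; rewrite /= in_itv /= ?(sq1 x y h) // (sq1 y x) // addrC.
Qed.

Definition cplx (a : R * R) : C := (a.1 +i* a.2)%C.

(** The square of the modulus of [p / q], pulled back along the symmetrization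
    map, is a continuous real function on a product of three closed discs.
    Boundedness matters because the supremum of an unbounded set of reals is 0
    by convention. *)
Lemma Gamma3_ratio_bounded (p q : {mpoly C[3]}) :
  (forall x, Gamma3 x -> q.@[tnth x] != 0) ->
  has_ubound [set normc (p.@[tnth x] / q.@[tnth x]) | x in @Gamma3 R]%classic.
Proof.
move=> q0; pose X := ((R * R) * ((R * R) * (R * R)))%type.
pose K : set X := (disc `*` (disc `*` disc))%classic.
have cK : compact K.
  by do 2! [apply: compact_setX; first exact: compact_disc]; exact: compact_disc.
pose s (a : X) : 3.-tuple C :=
  let z1 := cplx a.1 in let z2 := cplx a.2.1 in let z3 := cplx a.2.2 in
  [tuple z1 + z2 + z3; z1 * z2 + z1 * z3 + z2 * z3; z1 * z2 * z3].
have ccomp (g : X -> R * R) : continuous g -> ccontinuous (fun a => cplx (g a)).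
  by move=> cg; split=> a; apply: (continuous_comp (cg a));
    (exact: cvg_fst || exact: cvg_snd).
have c1 : ccontinuous (fun a : X => cplx a.1) by apply: ccomp => a; exact: cvg_fst.
have c2 : ccontinuous (fun a : X => cplx a.2.1).
  by apply: ccomp => a; apply: continuous_comp; [exact: cvg_snd|exact: cvg_fst].
have c3 : ccontinuous (fun a : X => cplx a.2.2).
  by apply: ccomp => a; apply: continuous_comp; [exact: cvg_snd|exact: cvg_snd].
have cs i : ccontinuous (fun a => tnth (s a) i).
  case: i => [[|[|[|//]]] ?]; rewrite /s; under eq_fun do rewrite (tnth_nth 0) /=;
  by do ?[apply: ccontinuousD | apply: ccontinuousM].
pose n2 (f : {mpoly C[3]}) (a : X) : R := normc f.@[tnth (s a)] ^+ 2.
have cn2 f : continuous (n2 f).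
  have [r1 r2] := ccontinuous_meval f cs.
  rewrite /n2; under eq_fun do rewrite sqr_normc !expr2.
  by move=> a; apply: cvgD; apply: cvgM; (exact: r1 || exact: r2).
have disc_norm a : disc a -> normc (cplx a) <= 1.
  by move=> da; rewrite -(@ler_sqr _ _ 1) ?nnegrE ?normc_ge0 // sqr_normc expr1n.
have GK a : K a -> Gamma3 (s a).
  case: a => a [b c] [/= da [db dc]]; exists (cplx a), (cplx b), (cplx c).
  by split => //; exact: disc_norm.
have [||b _ bmax] := @compact_EVT_max X R (fun a => n2 p a * (n2 q a)^-1) K _ cK.
- by exists ((0, 0), ((0, 0), (0, 0))); do !split; rewrite /disc /= expr0n addr0 ler01.
- apply: continuous_in_subspaceT => a /set_mem aK; apply: cvgM; first exact: cn2.
  apply: cvgV; last exact: cn2.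
  by rewrite /n2 expf_neq0 //; apply: contra (q0 _ (GK _ aK)) => /eqP/eq0_normc->.
exists (Num.sqrt (n2 p b * (n2 q b)^-1)) => _ [x Gx <-].
have [a aK <-] : (exists2 a, K a & s a = x)%classic.
  case: Gx => [[x1 y1]] [[x2 y2]] [[x3 y3]] [h1 h2 h3 ->].
  have norm_disc u v : normc (u +i* v)%C <= 1 -> disc (u, v).
    move=> h; rewrite /disc /= -[1](expr1n _ 2) -(sqr_normc (u +i* v)%C).
    by rewrite ler_sqr ?nnegrE ?normc_ge0.
  by exists ((x1, y1), ((x2, y2), (x3, y3))) => //; do !split; exact: norm_disc.
have := bmax a (mem_set aK); rewrite /n2 => le.
rewrite -[leLHS]ger0_norm ?normc_ge0 // -sqrtr_sqr ler_wsqrtr //.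
by rewrite normcM normcV exprMn exprVn.
Qed.

End Compactness.

(** * The cube of a weighted swap is a Gamma_3-contraction *)

Section CubeContraction.
Variable R : realType.
Local Notation C := R[i].

(** The homotopy [(x, y, z)] contracts the Koszul complex. *)
Lemma koszul_exact_of_unit_combination n (a b c x y z : 'M[C]_n) :
  a *m b = b *m a -> a *m c = c *m a -> b *m c = c *m b ->
  (forall m, m \in [:: a; b; c] ->
     [/\ m *m x = x *m m, m *m y = y *m m & m *m z = z *m m]) ->
  x *m a + y *m b + z *m c = 1%:M -> koszul_exact a b c.
Proof.
move=> ab ac bc xyz e.
have [] := xyz a; first by rewrite !inE eqxx.
move=> ax ay az.
have [] := xyz b; first by rewrite !inE eqxx orbT.
move=> bx by_ bz.
have [] := xyz c; first by rewrite !inE eqxx !orbT.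
move=> cx cy cz {xyz}.
have E (s : 'cV[C]_n) : s = x *m (a *m s) + y *m (b *m s) + z *m (c *m s).
  by rewrite !mulmxA -!mulmxDl e mul1mx.
split.
- by move=> s as0 bs0 cs0; rewrite (E s) as0 bs0 cs0 !mulmx0 !addr0.
- move=> X Y Z /subr0_eq h1 /subr0_eq h2 /subr0_eq h3.
  exists (x *m X + y *m Y + z *m Z); split; rewrite !mulmxDr !mulmxA.
  + by rewrite ax ay az -!mulmxA h1 h2 -E.
  + by rewrite bx by_ bz -!mulmxA -h1 h3 -E.
  + by rewrite cx cy cz -!mulmxA -h2 -h3 -E.
- move=> u v w h.
  have hb : b *m v = a *m w + c *m u.
    by apply/eqP; rewrite eq_sym -subr_eq0 addrAC h.
  exists (- (y *m u + z *m v)), (x *m u - z *m w), (x *m v + y *m w).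
  split; rewrite ?(mulmxN, mulmxDr, mulmxBr) !mulmxA.
  + rewrite ax az by_ bz -!mulmxA hb mulmxDr {1}(E u).
    by apply/matrixP => i j; rewrite !mxE; ring.
  + rewrite ax ay cy cz -!mulmxA {1}(E v) hb mulmxDr.
    by apply/matrixP => i j; rewrite !mxE; ring.
  + rewrite bx by_ cx cz -!mulmxA hb mulmxDr {1}(E w).
    by apply/matrixP => i j; rewrite !mxE; ring.
- move=> s; exists (z *m s), (- (y *m s)), (x *m s).
  by rewrite mulmxN opprK !mulmxA ax by_ cz -!mulmxA -E.
Qed.

Lemma poly_calculus_horner_mx n (T : 'M[C]_n.+1) (h : 'I_3 -> {poly C})
    (S : 3.-tuple 'M[C]_n.+1) (p : {mpoly C[3]}) :
  (forall i, tnth S i = horner_mx T (h i)) ->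
  poly_calculus p S = horner_mx T (mmap polyC h p).
Proof.
move=> Sh; rewrite /poly_calculus /mmap rmorph_sum; apply: eq_bigr => m _.
rewrite rmorphM /= horner_mx_C /mmap1 rmorph_prod; congr (_ * _).
by apply: eq_bigr => i _; rewrite rmorphXn Sh.
Qed.

Lemma horner_mmap (h : 'I_3 -> {poly C}) (p : {mpoly C[3]}) (z : C) :
  (mmap polyC h p).[z] = p.@[fun i => (h i).[z]].
Proof.
rewrite /mmap mevalE horner_sum; apply: eq_bigr => m _.
rewrite hornerM hornerC /mmap1 horner_prod; congr (_ * _).
by apply: eq_bigr => i _; rewrite horner_exp.
Qed.

(** The symmetrization of [('X, 'X, 'X)]. *)
Definition cubeX : 3.-tuple {poly C} := [tuple 3 *: 'X; 3 *: 'X^2; 'X^3].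

Lemma horner_cubeX (z : C) :
  (fun i => (tnth cubeX i).[z]) = tnth [tuple 3 * z; 3 * z ^+ 2; z ^+ 3].
Proof.
apply/funext => i; rewrite !(tnth_nth 0).
by case: i => [[|[|[|//]]] ?] /=; rewrite !(hornerZ, hornerX, hornerXn).
Qed.

Lemma Gamma3_cube (z : C) :
  normc z <= 1 -> Gamma3 [tuple 3 * z; 3 * z ^+ 2; z ^+ 3].
Proof.
move=> z1; exists z, z, z; split=> //; apply: val_inj => /=.
by congr [:: _; _; _]; ring.
Qed.

Lemma vnorm0 n : vnorm (0 : 'cV[C]_n) = 0.
Proof. by rewrite /vnorm big1 ?sqrtr0 // => i _; rewrite mxE normc0 expr0n. Qed.

Lemma opnorm_le n (A : 'M[C]_n) (M : R) :
  (forall v, vnorm v <= 1 -> vnorm (A *m v) <= M) -> opnorm A <= M.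
Proof.
move=> AM; apply: ge_sup; last by move=> _ [v v1 <-]; exact: AM.
by exists (vnorm (A *m 0)); exists 0 => //=; rewrite vnorm0.
Qed.

(** The commutative algebra spanned by 1 and the swap contains all matrices
    that occur in the computation of the Taylor spectrum. *)
Definition swap_comb (c a b : C) : 'M[C]_2 := a%:M + b *: weighted_swap c.

Lemma swap_combM (c a b a' b' : C) :
  swap_comb c a b *m swap_comb c a' b'
  = swap_comb c (a * a' + b * b' * c) (a * b' + b * a').
Proof.
rewrite /swap_comb mulmxDl !mulmxDr -scalar_mxM !mul_scalar_mx -!scalemxAl.
rewrite mul_mx_scalar -scalemxAr weighted_swap_sqr.
apply/matrixP => i j; move: (weighted_swap c) => T; rewrite !mxE.
by case: (i == j); rewrite ?mulr1n ?mulr0n; ring.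
Qed.

Lemma swap_combC (c a b a' b' : C) :
  swap_comb c a b *m swap_comb c a' b' = swap_comb c a' b' *m swap_comb c a b.
Proof. by rewrite !swap_combM; congr swap_comb; ring. Qed.

Lemma swap_combD (c a b a' b' : C) :
  swap_comb c a b + swap_comb c a' b' = swap_comb c (a + a') (b + b').
Proof. by rewrite /swap_comb raddfD scalerDl /= addrACA. Qed.

(** Off the two joint eigenvalues [(3 r, 3 r^2, r^3)], [r^2 = c], some
    combination of the three shifted operators is 1.  When [l_1 = 3 c] and
    [l_0 = 3 r], it combines the first and the third one, since
    [(c T - l_2) - (c / 3) (3 T - l_0)] is the scalar [c r - l_2]. *)
Lemma taylor_spectrum_cube (c : C) : normc c < 1 ->
  (taylor_spectrum [tuple 3 *: weighted_swap c; (3 * c)%:M; c *: weighted_swap c]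
    `<=` @Gamma3 R)%classic.
Proof.
move=> c1 l nk; apply: contrapT => nG; apply: nk.
set S := [tuple 3 *: weighted_swap c; _; _].
have -> : tnth S 0 - (tnth l 0)%:M = swap_comb c (- tnth l 0) 3.
  by rewrite addrC -raddfN.
have -> : tnth S 1 - (tnth l 1)%:M = swap_comb c (3 * c - tnth l 1) 0.
  by rewrite /swap_comb scale0r addr0 raddfB.
have -> : tnth S 2 - (tnth l 2)%:M = swap_comb c (- tnth l 2) c.
  by rewrite addrC -raddfN.
set l0 := tnth l 0 in nG *; set l1 := tnth l 1 in nG *; set l2 := tnth l 2 in nG *.
suff [a [b [a' [b' [a'' [b'' [h1 h2]]]]]]] : exists a b a' b' a'' b'' : C,
    a * - l0 + b * 3 * c + (a' * (3 * c - l1)) + (a'' * - l2 + b'' * c * c) = 1 /\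
    a * 3 + b * - l0 + (b' * (3 * c - l1)) + (a'' * c + b'' * - l2) = 0.
  apply: (@koszul_exact_of_unit_combination _ _ _ _
    (swap_comb c a b) (swap_comb c a' b') (swap_comb c a'' b''));
    try exact: swap_combC.
    by move=> m; rewrite !inE => /or3P[] /eqP->; split; exact: swap_combC.
  have -> : 1%:M = swap_comb c 1 0 by rewrite /swap_comb scale0r addr0.
  rewrite !swap_combM !swap_combD; congr swap_comb.
    by rewrite -[RHS]h1; ring.
  by rewrite -[RHS]h2; ring.
have [e1|n1] := eqVneq l1 (3 * c); last first.
  exists 0, 0, (3 * c - l1)^-1, 0, 0, 0; split; last by ring.
  by rewrite mulVf ?subr_eq0 1?eq_sym //; ring.
have [e0|n0] := eqVneq (l0 ^+ 2) (9 * c); last first.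
  have d0 : 9 * c - l0 ^+ 2 != 0 by rewrite subr_eq0 eq_sym.
  exists (l0 / (9 * c - l0 ^+ 2)), (3 / (9 * c - l0 ^+ 2)), 0, 0, 0, 0.
  by split; field.
pose r := l0 / 3.
have l0E : l0 = 3 * r by rewrite /r; field.
have rc : r ^+ 2 = c by rewrite /r expr_div_n e0; field.
have r1 : normc r <= 1.
  by rewrite -(@ler_sqr _ _ 1) ?nnegrE ?normc_ge0 // -normcX rc expr1n ltW.
have n2 : c * r - l2 != 0.
  rewrite subr_eq0; apply/eqP => e2; apply: nG.
  have -> : l = [tuple 3 * r; 3 * r ^+ 2; r ^+ 3]; last exact: Gamma3_cube.
  apply: eq_from_tnth => i; rewrite [RHS](tnth_nth 0).
  have -> : r ^+ 3 = l2 by rewrite -e2 -rc; ring.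
  rewrite rc -l0E -e1.
  by case: i => [[|[|[|//]]] ?] /=; congr tnth; apply: val_inj.
exists (- (c / 3) / (c * r - l2)), 0, 0, 0, (c * r - l2)^-1, 0.
by split; rewrite l0E; field.
Qed.

Lemma cube_contraction (c : C) : normc c < 1 ->
  Gamma3_contraction (3 *: weighted_swap c) (3 * c)%:M (c *: weighted_swap c).
Proof.
move=> c1; set T := weighted_swap c.
pose S := [tuple 3 *: T; (3 * c)%:M; c *: T].
have TT : T *m T = c%:M := weighted_swap_sqr c.
have Sh i : tnth S i = horner_mx T (tnth cubeX i).
  rewrite !(tnth_nth 0); case: i => [[|[|[|//]]] ?] /=;
    rewrite ?linearZ /= ?rmorphXn /= horner_mx_X //.
    by rewrite expr2 -[T * T]/(T *m T) TT scale_scalar_mx.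
  by rewrite exprS expr2 -[T * T]/(T *m T) TT -[T * _]/(T *m _) mul_mx_scalar.
split.
  by move=> i j; rewrite !Sh -![_ *m _]/(_ * _) -!rmorphM mulrC.
split; first exact: taylor_spectrum_cube.
move=> p q q0.
set P := mmap polyC (tnth cubeX) p; set Q := mmap polyC (tnth cubeX) q.
rewrite (poly_calculus_horner_mx p Sh) (poly_calculus_horner_mx q Sh) -/P -/Q.
have PE z : P.[z] = p.@[tnth [tuple 3 * z; 3 * z ^+ 2; z ^+ 3]].
  by rewrite horner_mmap horner_cubeX.
have QE z : Q.[z] = q.@[tnth [tuple 3 * z; 3 * z ^+ 2; z ^+ 3]].
  by rewrite horner_mmap horner_cubeX.
have Q0 z : normc z <= 1 -> Q.[z] != 0.
  by move=> z1; rewrite QE q0 //; exact: Gamma3_cube.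
set M := sup _.
have QM z : normc z <= 1 -> normc P.[z] <= M * normc Q.[z].
  move=> z1; have Qz : 0 < normc Q.[z] by rewrite normc_gt0 Q0.
  rewrite -ler_pdivrMr // -normcV -normcM; apply: ub_le_sup.
    exact: Gamma3_ratio_bounded.
  by exists [tuple 3 * z; 3 * z ^+ 2; z ^+ 3]; [exact: Gamma3_cube | rewrite PE QE].
have M0 : 0 <= M.
  have n1 : normc (1 : C) <= 1 by rewrite normc1.
  have Q1 : 0 < normc Q.[1] by rewrite normc_gt0 Q0.
  by rewrite -(pmulr_lge0 _ Q1); apply: le_trans (QM _ n1); exact: normc_ge0.
apply: opnorm_le => v v1; rewrite -mulmxA.
apply: le_trans (von_neumann (M := M) (Q := Q) _ c1 Q0 _) _.
  by move=> z z1; apply: QM; rewrite z1.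
by rewrite mulKVmx ?horner_weighted_swap_unit // ler_piMr.
Qed.

End CubeContraction.

(** * Operators on a full defect space *)

Section DefectSpace.
Variable R : realType.
Local Notation C := R[i].

Definition vs_lift n (U : {vspace 'cV[C]_n}) (M : 'M[C]_n) : 'End(subvs_of U) :=
  linfun (vsproj U \o mulmx M \o vsval).

Section FullSubspace.
Variables (n : nat) (U : {vspace 'cV[C]_n}).
Hypothesis fullU : forall v, v \in U.

Lemma vs_liftE M u : vsval (vs_lift U M u) = M *m vsval u.
Proof. by rewrite lfunE /= vsprojK. Qed.

Lemma vs_lift_comp M N : (vs_lift U M \o vs_lift U N)%VF = vs_lift U (M *m N).
Proof.
by apply/lfunP => u; apply: val_inj; rewrite comp_lfunE /= !vs_liftE mulmxA.
Qed.

Lemma vs_lift_inj : injective (vs_lift U).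
Proof.
move=> M N MN; apply/matrixP => i j.
have := congr1 (fun A : 'End(subvs_of U) =>
  vsval (A (vsproj U (delta_mx j 0 : 'cV_n)))) MN.
rewrite !vs_liftE !vsprojK // => /matrixP/(_ i 0).
by rewrite -!colE !mxE.
Qed.

Lemma vs_lift_scalar l M : vs_lift U M - l *: \1%VF = vs_lift U (M - l%:M).
Proof.
apply/lfunP => u; apply: val_inj.
by rewrite add_lfunE opp_lfunE scale_lfunE id_lfunE /= !vs_liftE mulmxBl mul_scalar_mx.
Qed.

Lemma vs_lift1 : vs_lift U 1%:M = \1%VF.
Proof. by apply/lfunP => u; apply: val_inj; rewrite /= vs_liftE mul1mx id_lfunE. Qed.

Lemma vs_lift0 : vs_lift U 0 = 0.
Proof.
by apply/lfunP => u; apply: val_inj; rewrite /= vs_liftE mul0mx zero_lfunE linear0.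
Qed.

(** Both square roots [l], [- l] of [m] are eigenvalues: if [M - l] had a left
    inverse, then [(M - l) (M + l) = 0] would make [M] the scalar [- l]. *)
Lemma spectrum_vs_lift_sqr (M : 'M[C]_n) (m : C) :
  M *m M = m%:M -> (forall l, M != l%:M) ->
  spectrum (vs_lift U M) = [set l | l ^+ 2 = m]%classic.
Proof.
move=> MM Mns.
have fact l : (M - l%:M) *m (M + l%:M) = (m - l ^+ 2)%:M
    /\ (M + l%:M) *m (M - l%:M) = (m - l ^+ 2)%:M.
  split; rewrite !(mulmxDl, mulmxDr, mulmxBl, mulmxBr, mulmxN, mulNmx) MM;
    rewrite !mul_scalar_mx !mul_mx_scalar;
    apply/matrixP => i j; rewrite !mxE; case: (i == j);
    rewrite ?mulr1n ?mulr0n; ring.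
apply/seteqP; split=> l /=.
  move=> nl; apply/eqP; rewrite -subr_eq0; apply: contrapT => /negP nz; apply: nl.
  have nz' : m - l ^+ 2 != 0 by rewrite -opprB oppr_eq0.
  have [f1 f2] := fact l.
  exists (vs_lift U ((m - l ^+ 2)^-1 *: (M + l%:M))).
  rewrite vs_lift_scalar !vs_lift_comp -vs_lift1 -scalemxAl -scalemxAr f1 f2.
  by rewrite scale_scalar_mx mulVf.
move=> lm [B [BM _]].
have : vs_lift U (M + l%:M) = 0.
  rewrite -[LHS]comp_lfun1l -BM -comp_lfunA vs_lift_scalar vs_lift_comp (fact l).1.
  by rewrite lm subrr raddf0 vs_lift0 comp_lfun0r.
rewrite -vs_lift0 => /vs_lift_inj/eqP; rewrite addr_eq0 -raddfN => /eqP e.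
by have := Mns (- l); rewrite e eqxx.
Qed.

End FullSubspace.

Lemma defect_space_full n (P : 'M[C]_n) : defect_op P \in unitmx ->
  forall v, v \in defect_space P.
Proof.
move=> Du v; apply/memv_imgP.
exists (invmx (defect_op P) *m v); first exact: memvf.
by rewrite lfunE /= mulKVmx.
Qed.

Lemma defect_sandwich_vs_lift n (P K : 'M[C]_n) (h : 'cV[C]_n) :
  defect_op P \in unitmx ->
  defect_sandwich (vs_lift (defect_space P)
    (invmx (defect_op P) *m K *m invmx (defect_op P))) h = K *m h.
Proof.
move=> Du; rewrite /defect_sandwich vs_liftE; last exact: defect_space_full.
rewrite vsprojK; last exact: defect_space_full.
by rewrite -!mulmxA mulKmx // mulKVmx.
Qed.

(** [defect_op] is chosen among the positive square roots, so its square is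
    known once some root [D] is exhibited. *)
Lemma defect_op_sqr n (P D : 'M[C]_n) : psdmx D -> D *m D = 1%:M - P ^t* *m P ->
  defect_op P *m defect_op P = 1%:M - P ^t* *m P.
Proof.
move=> D0 DD; rewrite /defect_op /psd_sqrt; set A := (X in xget _ X).
have AD : A D by [].
by have [] := xgetPex 0 (ex_intro A D AD).
Qed.

Lemma psdmx_diag n (d : 'rV[C]_n) : (forall i, 0 <= d 0 i) -> psdmx (diag_mx d).
Proof.
move=> d0; split.
  apply/matrixP => i j; rewrite !mxE eq_sym rmorphMn /=.
  by case: eqVneq => [->|]; rewrite ?mulr0n // !mulr1n conj_Creal // ger0_real.
move=> v; rewrite -mulmxA mul_diag_mx mxE sumr_ge0 // => i _.
by rewrite !mxE mulrCA mulr_ge0 // mulrC mul_conjC_ge0.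
Qed.

(** With [D = D_P], the fundamental operators are [A_i = D^-1 K_i D^-1], hence
    [A_i A_j = D^-1 (K_i D^-2 K_j) D^-1] involves [D] only through [D^2]. *)
Lemma fundamental_pair_spectrum n (S1 S2 P K1 K2 W : 'M[C]_n) (m : C) :
  let Q := defect_op P *m defect_op P in
  Q *m W = 1%:M -> S1 - S2 ^t* *m P = K1 -> S2 - S1 ^t* *m P = K2 ->
  K1 *m W *m K1 = m *: Q -> (forall l, K1 != l *: Q) ->
  K1 *m W *m K2 <> K2 *m W *m K1 ->
  exists A1 A2 : 'End(subvs_of (defect_space P)),
  [/\ fundamental_operator_pair S1 S2 A1 A2, (A1 \o A2)%VF <> (A2 \o A1)%VF
    & spectrum A1 = [set l | l ^+ 2 = m]%classic].
Proof.
move=> Q QW E1 E2 K1sq K1ns K12; pose D := defect_op P.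
have Du : D \in unitmx.
  by case: (@mulmx1_unit _ _ D (D *m W)) => //; rewrite mulmxA.
have full := defect_space_full Du.
have iW : invmx D *m invmx D = W.
  by rewrite -[LHS]mulmx1 -QW /Q -/D !mulmxA mulmxKV // mulVmx // mul1mx.
pose M K := invmx D *m K *m invmx D.
have MM K K' : M (K *m W *m K') = M K *m M K' by rewrite /M -iW !mulmxA.
have MK K : D *m M K *m D = K by rewrite /M !mulmxA mulmxV // mul1mx mulmxKV.
exists (vs_lift _ (M K1)), (vs_lift _ (M K2)); split.
- by split=> h; rewrite defect_sandwich_vs_lift // ?E1 ?E2.
- move=> e; apply: K12.
  have {}e := vs_lift_inj full
    (etrans (esym (vs_lift_comp full _ _)) (etrans e (vs_lift_comp full _ _))).
  have {}e := etrans (MM K1 K2) (etrans e (esym (MM K2 K1))).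
  exact: etrans (esym (MK _)) (etrans (congr1 (fun X => D *m X *m D) e) (MK _)).
apply: (spectrum_vs_lift_sqr full) => [|l].
  rewrite -MM K1sq /M -scalemxAr -scalemxAl /Q -/D !mulmxA mulVmx // mul1mx mulmxV //.
  by rewrite scale_scalar_mx mulr1.
apply: contraNneq (K1ns l) => e.
by rewrite -[K1]MK e mul_mx_scalar -scalemxAl.
Qed.

End DefectSpace.

(** * The fundamental operator pair of the example *)

Section Example.
Variable R : realType.
Local Notation C := R[i].

Let c : C := 3 / 4.
Let T := weighted_swap c.

Lemma conj_c : Num.conj c = c.
Proof. by rewrite fmorph_div !rmorph_nat. Qed.

Lemma normc_c : normc c < 1.
Proof.
have -> : c = (3 / 4 : R)%:C%C by rewrite fmorph_div !rmorph_nat.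
have -> : normc (3 / 4 : R)%:C%C = 3 / 4.
  by apply: complexI; rewrite -normCE ger0_norm // ler0c; lra.
by lra.
Qed.

(* With P = c T, defect_sq is 1 - P^* P = diag (1 - c^4, 1 - c^2), and defect_sqV
   is its inverse; K1 = 3 (1 - c^2) T and K2 = 3 c (1 - c^2) diag (1, 0) are
   S1 - S2^* P and S2 - S1^* P. *)
Let defect_sq : 'M[C]_2 :=
  diag_mx (\row_i (if i == 0 then 175 / 256 else 7 / 16)).
Let defect_sqV : 'M[C]_2 :=
  diag_mx (\row_i (if i == 0 then 256 / 175 else 16 / 7)).
Let K1 : 'M[C]_2 := (21 / 16) *: T.
Let K2 : 'M[C]_2 := (63 / 64) *: delta_mx 0 0.

Lemma defect_sqE : 1%:M - (c *: T) ^t* *m (c *: T) = defect_sq.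
Proof.
apply/matrixP => i j; rewrite !mxE !big_ord_recl big_ord0 !mxE.
by case: i j => [[|[|//]] ?] [[|[|//]] ?] /=;
  rewrite ?(rmorphM, rmorph0, rmorph1, conj_c) /= ?mulr1n ?mulr0n /c; field.
Qed.

Lemma defect_sqK : defect_sq *m defect_sqV = 1%:M.
Proof.
rewrite /defect_sq /defect_sqV mul_diag_mx; apply/matrixP => i j; rewrite !mxE.
by case: i j => [[|[|//]] ?] [[|[|//]] ?] /=; rewrite ?mulr1n ?mulr0n; field.
Qed.

Lemma fundamental_equation1 : 3 *: T - (3 * c)%:M ^t* *m (c *: T) = K1.
Proof.
apply/matrixP => i j; rewrite !mxE !big_ord_recl big_ord0 !mxE.
by case: i j => [[|[|//]] ?] [[|[|//]] ?] /=; rewrite ?mulr1n ?mulr0n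
  ?(rmorphM, rmorph0, rmorph1, rmorph_nat, conj_c) /= /c; field.
Qed.

Lemma fundamental_equation2 : (3 * c)%:M - (3 *: T) ^t* *m (c *: T) = K2.
Proof.
apply/matrixP => i j; rewrite !mxE !big_ord_recl big_ord0 !mxE.
by case: i j => [[|[|//]] ?] [[|[|//]] ?] /=; rewrite ?mulr1n ?mulr0n
  ?(rmorphM, rmorph0, rmorph1, rmorph_nat, conj_c) /= /c; field.
Qed.

(** Conjugated by [D_P^-1], this says that the square of [A_1] is [108/25]. *)
Lemma K1_square : K1 *m defect_sqV *m K1 = (108 / 25) *: defect_sq.
Proof.
rewrite /defect_sqV mul_mx_diag; apply/matrixP => i j.
rewrite !mxE !big_ord_recl big_ord0 !mxE.
by case: i j => [[|[|//]] ?] [[|[|//]] ?] /=; rewrite ?mulr1n ?mulr0n /c; field.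
Qed.

(** Conjugated by [D_P^-1], this says that [A_1] and [A_2] do not commute. *)
Lemma K1_K2_noncommuting : K1 *m defect_sqV *m K2 <> K2 *m defect_sqV *m K1.
Proof.
have E12 : K1 *m defect_sqV *m K2 = (567 / 400) *: delta_mx 1 0.
  rewrite /defect_sqV mul_mx_diag; apply/matrixP => i j.
  rewrite !mxE !big_ord_recl big_ord0 !mxE.
  by case: i j => [[|[|//]] ?] [[|[|//]] ?] /=; rewrite ?mulr1n ?mulr0n /c; field.
have E21 : K2 *m defect_sqV *m K1 = (189 / 100) *: delta_mx 0 1.
  rewrite /defect_sqV mul_mx_diag; apply/matrixP => i j.
  rewrite !mxE !big_ord_recl big_ord0 !mxE.
  by case: i j => [[|[|//]] ?] [[|[|//]] ?] /=; rewrite ?mulr1n ?mulr0n /c; field.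
move=> e; have := etrans (esym E12) (etrans e E21).
move/(congr1 (fun X : 'M[C]_2 => X 0 1))/eqP.
by rewrite !mxE /= mulr0 mulr1 eq_sym mulf_eq0 invr_eq0 !pnatr_eq0.
Qed.

Lemma defect_op_example_sqr :
  defect_op (c *: T) *m defect_op (c *: T) = defect_sq.
Proof.
pose s : C := (Num.sqrt 7 / 4)%:C%C.
have s2 : s ^+ 2 = 7 / 16.
  rewrite -rmorphXn /= expr_div_n sqr_sqrtr ?ler0n // fmorph_div rmorphXn !rmorph_nat.
  by congr (_ / _); ring.
have s0 : 0 <= s by rewrite ler0c divr_ge0 ?sqrtr_ge0 ?ler0n.
rewrite (@defect_op_sqr _ _ _ (diag_mx (\row_i (if i == 0 then 5 / 4 * s else s))))
  ?defect_sqE //.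
  apply: psdmx_diag => i; rewrite mxE; case: ifP => // _.
  by rewrite mulr_ge0 // divr_ge0 ?ler0n.
rewrite mulmx_diag; congr diag_mx; apply/rowP => i; rewrite !mxE.
case: ifP => _; last by rewrite -s2.
have -> : 175 / 256 = 25 / 16 * (7 / 16) :> C by field.
by rewrite -s2; field.
Qed.

Lemma K1_not_multiple l : K1 != l *: defect_sq.
Proof.
apply/eqP => /(congr1 (fun X : 'M[C]_2 => X 0 1))/eqP.
by rewrite !mxE /= mulr0n mulr0 mulr1 mulf_eq0 invr_eq0 !pnatr_eq0.
Qed.

Lemma fundamental_pair_of_example :
  exists A1 A2 : 'End(subvs_of (defect_space (c *: T))),
  [/\ fundamental_operator_pair (3 *: T) (3 * c)%:M A1 A2,
      (A1 \o A2)%VF <> (A2 \o A1)%VF & 2 < spectral_radius A1].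
Proof.
have [] := fundamental_pair_spectrum (m := 108 / 25) _
  fundamental_equation1 fundamental_equation2 _ _ K1_K2_noncommuting.
- by rewrite defect_op_example_sqr; exact: defect_sqK.
- by rewrite defect_op_example_sqr; exact: K1_square.
- by move=> l; rewrite defect_op_example_sqr; exact: K1_not_multiple.
move=> A1 [A2 [fund ncomm specA1]]; exists A1, A2; split => //.
rewrite /spectral_radius specA1.
pose r : R := Num.sqrt (108 / 25).
have r2 : r ^+ 2 = 108 / 25 by rewrite sqr_sqrtr // divr_ge0.
have r0 : 0 <= r := sqrtr_ge0 _.
apply: (@lt_le_trans _ _ r); first by nra.
have normE (l : C) : l ^+ 2 = 108 / 25 -> normc l = r.
  move=> l2; apply/eqP; rewrite -(@eqrXn2 _ 2) ?normc_ge0 // -normcX l2 r2; apply/eqP.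
  apply: complexI; rewrite -normCE ger0_norm ?divr_ge0 ?ler0n //.
  by rewrite fmorph_div !rmorph_nat.
apply: ub_le_sup; first by exists r => _ [l l2 <-]; rewrite normE.
have rC : (r%:C%C : C) ^+ 2 = 108 / 25 by rewrite -rmorphXn r2 fmorph_div !rmorph_nat.
by exists r%:C%C => //; rewrite normE.
Qed.

End Example.

Theorem mainTheorem4 (R : realType) :
  exists S1 S2 P : 'M[R[i]]_2,
    Gamma3_contraction S1 S2 P /\
    exists A1 A2 : 'End(subvs_of (defect_space P)),
      [/\ fundamental_operator_pair S1 S2 A1 A2,
          (A1 \o A2)%VF <> (A2 \o A1)%VF
        & 2 < spectral_radius A1].
Proof.
exists (3 *: weighted_swap (3 / 4)), (3 * (3 / 4))%:M,
  ((3 / 4) *: weighted_swap (3 / 4)).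
split; first exact: cube_contraction (normc_c R).
exact: fundamental_pair_of_example.
Qed.
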